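(* $\mathcal{L}(\mathrm{ET0L}_{\mathrm{FIN}})\subset\mathcal{L}(\mathrm{IND}_{\mathrm{FIN}})$, where $\subset$ denotes strict inclusion; i.e. every finite-index ET0L language is a finite-index indexed language, and the converse fails.
   Context: An indexed grammar is a 5-tuple $G=(V,T,I,P,S)$ where $V,T,I$ are finite pairwise disjoint sets (variables, terminals, indices), $S\in V$ is the start variable, and $P$ is a finite set of productions of the forms (1) $A\to\nu$, (2) $A\to Bf$, (3) $Af\to\nu$, with $A,B\in V$, $f\in I$, $\nu\in(V\cup T)^*$. Sentential forms are words in $(VI^*\cup T)^*$. In one derivation step $\Rightarrow$, an occurrence $A\alpha$ in a sentential form ($A\in V$, $\alpha\in I^*$ the maximal word of indices following it) is replaced as follows: by (1) $A\to w_1C_1\cdots w_\ell C_\ell w_{\ell+1}$ ($w_j\in T^*$, $C_j\in V$), it is replaced by $w_1C_1\alpha\cdots w_\ell C_\ell\alpha w_{\ell+1}$; by (2) $A\to Bf$, it is replaced by $Bf\alpha$; by (3) $Af\to w_1C_1\cdots w_\ell C_\ell w_{\ell+1}$, if $\alpha=f\alpha'$, it is replaced by $w_1C_1\alpha'\cdots w_\ell C_\ell\alpha' w_{\ell+1}$. The generated language is $L(G)=\{u\in T^*: S\Rightarrow^* u\}$. $G$ is of index-$k$ if every $u\in L(G)$ has some derivation from $S$ in which every sentential form contains at most $k$ occurrences of variables. $\mathcal{L}(\mathrm{IND}_{\mathrm{FIN}})$ is the family of languages generated by an indexed grammar of index-$k$ for some $k\ge1$. An ET0L system is $G=(V,\mathcal{P},S,T)$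 with $V$ a finite alphabet, $T\subseteq V$ the terminals, $S\in V$ the axiom, $\mathcal{P}$ a finite set of tables, each table being a finite set of productions $a\to\alpha$ ($a\in V$, $\alpha\in V^*$) with at least one production for each $a\in V$. One writes $x\Rightarrow y$ if $y$ is obtained from $x$ by rewriting all letters of $x$ in parallel with productions from one single table. $L(G)=\{w\in T^*:S\Rightarrow^*w\}$. A symbol $a$ is active if some table contains $a\to\alpha$ with $\alpha\neq a$. $G$ is of index $k$ if every $w\in L(G)$ has a derivation in which every sentential form contains at most $k$ occurrences of active symbols; it is finite-index if it is of index $k$ for some $k$. $\mathcal{L}(\mathrm{ET0L}_{\mathrm{FIN}})$ is the family of languages generated by finite-index ET0L systems. *)

(* Defs.v *)
From HB Require Import structures.
From mathcomp Require Import all_boot.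

Set Implicit Arguments.
Unset Strict Implicit.
Unset Printing Implicit Defensive.

Definition language (Sigma : finType) := seq Sigma -> Prop.

Definition language_family := forall Sigma : finType, language Sigma -> Prop.

Definition strictly_included (F1 F2 : language_family) : Prop :=
  (forall (Sigma : finType) (L : language Sigma), F1 Sigma L -> F2 Sigma L) /\
  (exists (Sigma : finType) (L : language Sigma), F2 Sigma L /\ ~ F1 Sigma L).

(* [derivation step x s] : x => s_0 => s_1 => ... ; its sentential forms are
   the elements of [x :: s], and it derives [last x s] from [x]. *)
Fixpoint derivation (A : Type) (step : A -> A -> Prop) (x : A) (s : seq A) :
    Prop :=
  if s is y :: s' then step x y /\ derivation step y s' else True.

(* The disjointness of variables, terminals and indices is built in: they live
   in different types, and words over variables and terminals are words over
   the sum type.  The finite set of productions is given as three finite lists,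
   one for each form. *)
Record indexed_grammar (Sigma : finType) := IndexedGrammar {
  ind_var : finType;
  ind_index : finType;
  ind_start : ind_var;
  (* (A, nu)    stands for A -> nu   *)
  ind_plain : seq (ind_var * seq (ind_var + Sigma));
  (* (A, B, f)  stands for A -> B f  *)
  ind_push : seq (ind_var * ind_var * ind_index);
  (* (A, f, nu) stands for A f -> nu *)
  ind_pop : seq (ind_var * ind_index * seq (ind_var + Sigma))
}.

Section IndexedGrammar.
Variables (Sigma : finType) (G : indexed_grammar Sigma).

(* A letter is either a variable together with the maximal index word that
   follows it, or a terminal; this is the unique factorization of the words
   in (V I^* \cup T)^*. *)
Definition ind_form := seq (ind_var G * seq (ind_index G) + Sigma).

Definition distribute (alpha : seq (ind_index G))
    (nu : seq (ind_var G + Sigma)) : ind_form :=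
  [seq match c with inl C => inl (C, alpha) | inr a => inr a end | c <- nu].

Inductive ind_step : ind_form -> ind_form -> Prop :=
| IndPlain x y A alpha nu of (A, nu) \in ind_plain G :
    ind_step (x ++ inl (A, alpha) :: y) (x ++ distribute alpha nu ++ y)
| IndPush x y A B f alpha of (A, B, f) \in ind_push G :
    ind_step (x ++ inl (A, alpha) :: y) (x ++ inl (B, f :: alpha) :: y)
| IndPop x y A f alpha nu of (A, f, nu) \in ind_pop G :
    ind_step (x ++ inl (A, f :: alpha) :: y) (x ++ distribute alpha nu ++ y).

Definition ind_axiom : ind_form := [:: inl (ind_start G, [::])].

Definition ind_derivation_of (u : seq Sigma) (s : seq ind_form) : Prop :=
  derivation ind_step ind_axiom s /\ last ind_axiom s = map inr u.

Definition ind_language : language Sigma :=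
  fun u => exists s, ind_derivation_of u s.

Definition nb_variables (x : ind_form) : nat :=
  count (fun c => if c is inl _ then true else false) x.

Definition ind_index_k (k : nat) : Prop :=
  forall u, ind_language u ->
  exists s, ind_derivation_of u s /\
            all (fun x => nb_variables x <= k) (ind_axiom :: s).

End IndexedGrammar.

Definition IND_FIN : language_family := fun Sigma L =>
  exists (G : indexed_grammar Sigma) (k : nat),
    [/\ 1 <= k, ind_index_k G k & forall u, L u <-> ind_language G u].

(* The alphabet V, which contains the terminals, is [et0l_nonterm + Sigma]:
   [et0l_nonterm] is V minus the terminals.  Tables, finite sets of productions
   a -> alpha, are finite lists of pairs (a, alpha). *)
Record et0l_system (Sigma : finType) := ET0LSystem {
  et0l_nonterm : finType;
  et0l_tables : seq (seq ((et0l_nonterm + Sigma) * seq (et0l_nonterm + Sigma)));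
  et0l_axiom : et0l_nonterm + Sigma;
  et0l_complete : forall t, t \in et0l_tables ->
    forall a, exists alpha, (a, alpha) \in t
}.

Section ET0L.
Variables (Sigma : finType) (G : et0l_system Sigma).

Definition et0l_letter : finType := (et0l_nonterm G + Sigma)%type.

Definition et0l_form := seq et0l_letter.

(* [all2] also requires [x] and [ys] to have the same length. *)
Definition et0l_step (x y : et0l_form) : Prop :=
  exists2 t, t \in et0l_tables G &
  exists2 ys : seq et0l_form,
    all2 (fun a alpha => (a, alpha) \in t) x ys & y = flatten ys.

Definition et0l_start : et0l_form := [:: et0l_axiom G].

Definition et0l_derivation_of (w : seq Sigma) (s : seq et0l_form) : Prop :=
  derivation et0l_step et0l_start s /\ last et0l_start s = map inr w.

Definition et0l_language : language Sigma :=
  fun w => exists s, et0l_derivation_of w s.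

Definition active (a : et0l_letter) : bool :=
  has (fun t => has (fun p => (p.1 == a) && (p.2 != [:: a])) t) (et0l_tables G).

Definition et0l_index_k (k : nat) : Prop :=
  forall w, et0l_language w ->
  exists s, et0l_derivation_of w s /\
            all (fun x => count active x <= k) (et0l_start :: s).

End ET0L.

Definition ET0L_FIN : language_family := fun Sigma L =>
  exists (G : et0l_system Sigma) (k : nat),
    et0l_index_k G k /\ forall w, L w <-> et0l_language G w.

(* Main.v *)
(* Inclusion: an indexed grammar guesses the sequence of tables of a derivation
   on its index stack, then every letter of a sentential form pops the next
   table and is rewritten by it.  Treating the letters level by level keeps at
   most 2k variables, since an inactive letter of a successful derivation is a
   terminal and can be emitted at once.

   Strictness: the Dyck language with two types of brackets is generated with a
   single variable by simulating a pushdown automaton.  Suppose that an ET0L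
   system of index k generates it.  At each time of a derivation of a word w, the
   positions of w yielded by active letters form at most k intervals.  Take for w
   a complete ternary tree of height 2k in which every node opens with the
   same block u of n brackets and closes with the mirror image of u.  If, at all
   times, the two blocks of every node were on the same side, then the number of
   interval ends would grow with the height and exceed 2k.  So, at some time,
   some node has its opening block inside and its closing block outside the
   intervals, or conversely.  There are 2^n choices of u, but only
   polynomially many (in n) lists of active letters and intervals, so two
   derivations, for u and v distinct, agree on those; grafting the active part
   of one into the other generates a word in which a block u is closed by the
   mirror image of v. *)

Require Import Defs.
From HB Require Import structures.
From mathcomp Require Import all_boot.
From mathcomp Require Import zify.

Set Implicit Arguments.
Unset Strict Implicit.
Unset Printing Implicit Defensive.

(** * Derivations *)

Section IndexedDerivations.
Variables (Sigma : finType) (G : indexed_grammar Sigma).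
Implicit Types (x y z : ind_form G) (k : nat).

Definition bounded_derives k x y :=
  exists s, [/\ derivation (@ind_step _ G) x s, last x s = y &
                all (fun x => nb_variables x <= k) (x :: s)].

Lemma bounded_derives_refl k x : nb_variables x <= k -> bounded_derives k x x.
Proof. by move=> kx; exists [::]; split=> //=; rewrite kx. Qed.

Lemma bounded_derives_step k x y z : nb_variables x <= k ->
  ind_step x y -> bounded_derives k y z -> bounded_derives k x z.
Proof. by move=> kx xy [s [ds ls /= ks]]; exists (y :: s); rewrite /= kx. Qed.

Lemma bounded_derives_trans k y x z :
  bounded_derives k x y -> bounded_derives k y z -> bounded_derives k x z.
Proof.
move=> [s [ds ls ks]] yz; elim: s x ds ls ks => [|x1 s IHs] x /=.
  by move=> _ -> _.
move=> [xx1 ds] ls /andP[kx ks].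
by apply: bounded_derives_step kx xx1 _; apply: IHs.
Qed.

Lemma nb_variables_cat x y :
  nb_variables (x ++ y) = nb_variables x + nb_variables y.
Proof. exact: count_cat. Qed.

Lemma nb_variables_word (u : seq Sigma) :
  nb_variables (map inr u : ind_form G) = 0.
Proof. by elim: u. Qed.

(** Soundness of a grammar is proved by an invariant: [sem p v] constrains the words [v] generated
    from [p], and it suffices that each production, read backwards, preserves it. *)
Variable sem : ind_var G * seq (ind_index G) -> seq Sigma -> Prop.

Definition sem_letter (c : ind_var G * seq (ind_index G) + Sigma) v : Prop :=
  match c with inl p => sem p v | inr a => v = [:: a] end.

Fixpoint sem_form x v : Prop :=
  if x is c :: x' then
    exists v1 v2, [/\ v = v1 ++ v2, sem_letter c v1 & sem_form x' v2]
  else v = [::].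

Lemma sem_form_cat x y v : sem_form (x ++ y) v <->
  exists v1 v2, [/\ v = v1 ++ v2, sem_form x v1 & sem_form y v2].
Proof.
elim: x v => [|c x IHx] v /=; split.
- by move=> yv; exists [::], v.
- by move=> [v1 [v2 [-> -> yv]]].
- move=> [v1 [v2 [-> cv1 /IHx[v3 [v4 [-> xv3 yv4]]]]]].
  by exists (v1 ++ v3), v4; rewrite catA; split=> //; exists v1, v3.
- move=> [_ [v4 [-> [v1 [v3 [-> cv1 xv3]] yv4]]]].
  exists v1, (v3 ++ v4); rewrite catA; split=> //.
  by apply/IHx; exists v3, v4.
Qed.

Hypothesis sem_plain : forall A alpha nu v, (A, nu) \in ind_plain G ->
  sem_form (distribute alpha nu) v -> sem (A, alpha) v.
Hypothesis sem_push : forall A B f alpha v, (A, B, f) \in ind_push G ->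
  sem (B, f :: alpha) v -> sem (A, alpha) v.
Hypothesis sem_pop : forall A f alpha nu v, (A, f, nu) \in ind_pop G ->
  sem_form (distribute alpha nu) v -> sem (A, f :: alpha) v.

Lemma sem_form_replace x y p z v : (forall v', sem_form z v' -> sem p v') ->
  sem_form (x ++ z ++ y) v -> sem_form (x ++ inl p :: y) v.
Proof.
move=> zp /sem_form_cat[v1 [_ [-> xv1 /sem_form_cat[v2 [v3 [-> zv2 yv3]]]]]].
apply/sem_form_cat; exists v1, (v2 ++ v3); split=> //.
by exists v2, v3; split=> //; apply: zp.
Qed.

Lemma sem_form_step x y v : ind_step x y -> sem_form y v -> sem_form x v.
Proof.
case=> {x y} [x y A alpha nu Pp|x y A B f alpha Pp|x y A f alpha nu Pp].
- by apply: sem_form_replace => v'; apply: sem_plain.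
- rewrite -[inl (B, _) :: y]/([:: inl (B, f :: alpha)] ++ y).
  apply: sem_form_replace => v' [v1 [v2 [-> Bv1 /= ->]]]; rewrite cats0.
  exact: sem_push Pp Bv1.
- by apply: sem_form_replace => v'; apply: sem_pop.
Qed.

Lemma sem_form_word (u : seq Sigma) : sem_form (map inr u) u.
Proof. by elim: u => //= a u IHu; exists [:: a], u. Qed.

Lemma ind_language_sem u : ind_language G u -> sem (ind_start G, [::]) u.
Proof.
case=> s [ds ls].
suff: sem_form (ind_axiom G) u by case=> v1 [v2 [-> ? /= ->]]; rewrite cats0.
elim: s (ind_axiom G) ds ls => [|y s IHs] x /= => [_ ->|[xy ds] ls].
  exact: sem_form_word.
by apply: sem_form_step xy _; apply: IHs.
Qed.

End IndexedDerivations.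

Lemma IND_FIN_intro (Sigma : finType) (L : language Sigma)
    (G : indexed_grammar Sigma) k : 0 < k ->
  (forall u, ind_language G u -> L u) ->
  (forall u, L u -> bounded_derives k (ind_axiom G) (map inr u)) ->
  IND_FIN L.
Proof.
move=> k_gt0 GL LG; exists G, k; split=> // u.
  by move=> /GL/LG[s [ds ls ks]]; exists s.
by split=> [/LG[s [ds ls _]]|/GL //]; exists s.
Qed.

Section ET0LDerivations.
Variables (Sigma : finType) (G : et0l_system Sigma).
Notation letter := (et0l_letter G).
Notation form := (et0l_form G).
Notation table := (seq_sub (et0l_tables G)).
Implicit Types (x y z : form) (a : letter) (ts : seq table).

(** The sequence of tables is a parameter, so that derivations sharing it can be juxtaposed;
    [seq_sub] makes the tables a finite type, fit to be an index alphabet. *)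
Fixpoint derives ts x z : Prop :=
  if ts is t :: ts' then
    exists2 ys : seq form,
      all2 (fun a alpha => (a, alpha) \in ssval t) x ys &
      derives ts' (flatten ys) z
  else x = z.

Lemma derives_cat ts x1 x2 z1 z2 : derives ts x1 z1 -> derives ts x2 z2 ->
  derives ts (x1 ++ x2) (z1 ++ z2).
Proof.
elim: ts x1 x2 => [|t ts IHts] x1 x2 /= => [-> -> //|[ys1 ty1 d1] [ys2 ty2 d2]].
exists (ys1 ++ ys2); last by rewrite flatten_cat; apply: IHts.
rewrite all2E in ty1; rewrite all2E in ty2; rewrite all2E.
case/andP: ty1 => /eqP s1 a1; case/andP: ty2 => /eqP s2 a2.
by rewrite !size_cat s1 s2 eqxx zip_cat // all_cat a1 a2.
Qed.

Lemma derives_nil ts : derives ts [::] [::].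
Proof. by elim: ts => //= t ts IHts; exists [::]. Qed.

Lemma derives_flatten ts (I : eqType) (r : seq I) (F H : I -> form) :
  (forall i, i \in r -> derives ts (F i) (H i)) ->
  derives ts (flatten (map F r)) (flatten (map H r)).
Proof.
elim: r => [|i r IHr] rP /=; first exact: derives_nil.
apply: derives_cat; first by apply: rP; rewrite mem_head.
by apply: IHr => j rj; apply: rP; rewrite inE rj orbT.
Qed.

Lemma derives1 (t : table) ts a alpha z : (a, alpha) \in ssval t ->
  derives ts alpha z -> derives (t :: ts) [:: a] z.
Proof. by move=> ta dz; exists [:: alpha]; rewrite /= ?ta ?cats0. Qed.

Lemma inactive_rule (t : table) a alpha : ~~ active a ->
  (a, alpha) \in ssval t -> alpha = [:: a].
Proof.
move=> + ta; apply: contraNeq => na; apply/hasP; exists (ssval t).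
  exact: (ssvalP t).
by apply/hasP; exists (a, alpha); rewrite //= eqxx.
Qed.

Lemma inactive_derives ts a : ~~ active a -> derives ts [:: a] [:: a].
Proof.
move=> a_in; elim: ts => //= t ts IHts.
have [alpha ta] := et0l_complete (ssvalP t) a.
by exists [:: alpha]; rewrite /= ?ta // (inactive_rule a_in ta).
Qed.

Lemma derives_inactive ts a z : ~~ active a -> derives ts [:: a] z -> z = [:: a].
Proof.
move=> a_in; elim: ts => [//|t ts IHts] /= [[|alpha [|? ?]] //=].
- by rewrite andbT cats0 => /(inactive_rule a_in) ->.
- by rewrite andbF.
Qed.

Lemma derives_derivation ts x z : derives ts x z ->
  exists2 s, derivation (@et0l_step _ G) x s & last x s = z.
Proof.
elim: ts x => [|t ts IHts] x /= => [->|[ys ty /IHts[s ds ls]]].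
  by exists [::].
exists (flatten ys :: s) => //=; split=> //.
by exists (ssval t); [exact: ssvalP | exists ys].
Qed.

Lemma derives_language ts w :
  derives ts (et0l_start G) (map inr w) -> et0l_language G w.
Proof. by case/derives_derivation=> s ds ls; exists s. Qed.

Lemma inactive_step x y a : ~~ active a -> et0l_step x y -> a \in x -> a \in y.
Proof.
move=> a_in [t tG [ys ty ->]].
elim: x ys ty => [|b x IHx] [|alpha ys] //= /andP[tb ty].
rewrite in_cons mem_cat => /predU1P[ab|/(IHx _ ty) ->]; last by rewrite orbT.
rewrite -ab in tb.
by rewrite (@inactive_rule (SeqSub tG) a alpha a_in tb) mem_head.
Qed.

(** This excludes inactive nonterminals from derivations of terminal words: they would still be
    there at the end. *)
Lemma inactive_derivation x s a : ~~ active a ->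
  derivation (@et0l_step _ G) x s -> a \in x -> a \in last x s.
Proof.
move=> a_in; elim: s x => //= y s IHs x [xy ds] ax.
by apply: IHs => //; apply: inactive_step ax.
Qed.

End ET0LDerivations.

(** * Finite-index ET0L languages are finite-index indexed languages *)

Fixpoint until_bottom (T : Type) (s : seq (option T)) : seq T :=
  if s is Some a :: s' then a :: until_bottom s' else [::].

Section IndexedOfET0L.
Variables (Sigma : finType) (E : et0l_system Sigma).
Notation letter := (et0l_letter E).
Notation form := (et0l_form E).
Notation table := (seq_sub (et0l_tables E)).

(* [None] is the start variable, [Some None] guesses the sequence of tables,
   storing it on top of the bottom marker [None], and [Some (Some a)] stands
   for the letter [a]. *)
Definition sim_var : finType := option (option letter).
Definition sim_index : finType := option table.

(* Active terminals stay variables until they meet the bottom marker; an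
   inactive nonterminal never occurs in a successful derivation. *)
Definition sim_letter (a : letter) : sim_var + Sigma :=
  if a is inr s then if active a then inl (Some (Some a)) else inr s
  else inl (Some (Some a)).

Definition sim_grammar : indexed_grammar Sigma :=
  @IndexedGrammar Sigma sim_var sim_index None
    [:: (Some None, [:: sim_letter (et0l_axiom E)])]
    ((None, Some None, None) ::
     [seq (Some None, Some None, Some t) | t <- enum {: table}])
    ([seq (Some (Some (inr s : letter)), None, [:: inr s]) | s <- enum Sigma] ++
     [seq (Some (Some p.1), Some t, map sim_letter p.2)
        | t <- enum {: table}, p <- ssval t]).

(** The invariant for soundness. While tables are being guessed, those still to be pushed, [ts],
    will lie above the stored ones and so be applied first. *)
Definition sim_sem (p : sim_var * seq sim_index) (v : seq Sigma) : Prop :=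
  match p.1 with
  | None => et0l_language E v
  | Some None =>
      exists ts, derives (ts ++ until_bottom p.2) (et0l_start E) (map inr v)
  | Some (Some a) => derives (until_bottom p.2) [:: a : letter] (map inr v)
  end.

Definition instance (alpha : seq sim_index) (x : form) : ind_form sim_grammar :=
  distribute (G := sim_grammar) alpha (map sim_letter x).

Lemma instance_cat alpha x y :
  instance alpha (x ++ y) = instance alpha x ++ instance alpha y.
Proof. by rewrite /instance /distribute !map_cat. Qed.

Lemma nb_variables_instance alpha beta x :
  nb_variables (instance alpha x) = nb_variables (instance beta x).
Proof. by elim: x => //= a x; rewrite /nb_variables /= => ->; case: sim_letter. Qed.

Lemma sim_sem_letters alpha (x : form) v :
  sem_form (G := sim_grammar) sim_sem (instance alpha x) v ->
  derives (until_bottom alpha) x (map inr v).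
Proof.
elim: x v => [|a x IHx] v /=; first by move=> ->; apply: derives_nil.
move=> [v1 [v2 [-> av1 /IHx xv2]]]; rewrite map_cat -cat1s.
apply: derives_cat xv2; case: a av1 => [a|s] //=.
by case: ifPn => //= /inactive_derives sD ->; apply: sD.
Qed.

Lemma sim_grammar_sound u : ind_language sim_grammar u -> et0l_language E u.
Proof.
apply: (@ind_language_sem _ sim_grammar sim_sem).
- move=> A alpha nu v /=; rewrite mem_seq1 => /eqP[-> ->].
  by move=> /(@sim_sem_letters alpha [:: et0l_axiom E]) ?; exists [::].
- move=> A B f alpha v /=; rewrite in_cons => /predU1P[[-> -> ->]|].
    by move=> [ts]; apply: derives_language.
  case/mapP=> t _ [-> -> ->] [ts tsv]; exists (rcons ts t).
  by rewrite cat_rcons.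
- move=> A f alpha nu v /=; rewrite mem_cat => /orP[/mapP|/allpairsPdep].
    move=> [s _ [-> -> ->]] /= [v1 [v2 [-> -> ->]]].
    by rewrite /sim_sem.
  move=> [t [[a x] [_ tp [-> -> ->]]]] /= /sim_sem_letters xv.
  exact: derives1 tp xv.
Qed.

(** Inactive nonterminals are the only letters kept as variables without being active. *)
Lemma nb_variables_sim alpha (x : form) :
  (forall a, inl a \in x -> @active _ E (inl a)) ->
  nb_variables (instance alpha x) = count (@active _ E) x.
Proof.
elim: x => [//|a x IHx] xP.
rewrite -cat1s instance_cat nb_variables_cat count_cat IHx => [|b xb].
  congr (_ + _); case: a xP => [a|s] xP; first by rewrite /= xP // mem_head.
  by rewrite /instance /=; case: ifP.
by apply: xP; rewrite in_cons xb orbT.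
Qed.

Lemma sim_letter_step k (t : table) ts a alpha (y z : ind_form sim_grammar) :
  (a, alpha) \in ssval t ->
  nb_variables y + nb_variables (instance ts [:: a]) +
    nb_variables (instance ts alpha) + nb_variables z <= k ->
  bounded_derives k (y ++ instance (Some t :: ts) [:: a] ++ z)
    (y ++ instance ts alpha ++ z).
Proof.
move=> ta kP.
have [[s aE] | aE]: (exists s, sim_letter a = inr s /\ alpha = [:: a]) \/
    sim_letter a = inl (Some (Some a)).
- case: a ta {kP} => [a|s] ta /=; first by right.
  case: ifPn => [_|s_in]; [by right | left; exists s].
  by rewrite (inactive_rule s_in ta).
- case: aE kP => aE -> kP.
  have aI beta : instance beta [:: a] = [:: inr s] by rewrite /instance /= aE.
  rewrite !aI in kP *; apply: bounded_derives_refl.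
  by rewrite !nb_variables_cat; lia.
rewrite (nb_variables_instance _ (Some t :: ts) [:: a]) in kP.
apply: (@bounded_derives_step _ _ _ _ (y ++ instance ts alpha ++ z)).
- by rewrite !nb_variables_cat; lia.
- rewrite /instance /= aE; apply: IndPop.
  rewrite mem_cat; apply/orP; right; apply/allpairsPdep.
  by exists t, (a, alpha); rewrite mem_enum.
- by apply: bounded_derives_refl; rewrite !nb_variables_cat; lia.
Qed.

(** The letters are rewritten from left to right, [y] being the part already treated; intermediate
    forms mix letters of two consecutive levels, whence the sum of both counts. *)
Lemma sim_step k (t : table) ts (x : form) ys (y : ind_form sim_grammar) :
  all2 (fun a alpha => (a, alpha) \in ssval t) x ys ->
  nb_variables y + nb_variables (instance ts x) +
    nb_variables (instance ts (flatten ys)) <= k ->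
  bounded_derives k (y ++ instance (Some t :: ts) x)
    (y ++ instance ts (flatten ys)).
Proof.
elim: x y ys => [|a x IHx] y [|alpha ys] // => [_ kP|/andP[ta tx]].
  apply: bounded_derives_refl; rewrite nb_variables_cat.
  exact: leq_trans (leq_addr _ _) kP.
rewrite -[flatten _]/(alpha ++ flatten ys) => kP.
rewrite -[a :: x]cat1s !instance_cat !nb_variables_cat in kP *.
rewrite (nb_variables_instance ts (Some t :: ts) x) in kP.
apply: (@bounded_derives_trans _ _ _
    (y ++ instance ts alpha ++ instance (Some t :: ts) x)).
  apply: sim_letter_step => //; apply: leq_trans kP.
  by rewrite -!addnA !leq_add2l addnCA leq_add2l leq_addr.
rewrite !catA; apply: IHx => //.
rewrite nb_variables_cat (nb_variables_instance ts (Some t :: ts) x); lia.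
Qed.

(** Once the tables are used up, active terminals are still variables; popping the bottom marker
    releases them one by one. *)
Lemma sim_bottom k w (y : ind_form sim_grammar) :
  nb_variables y + nb_variables (instance [:: None] (map inr w)) <= k ->
  bounded_derives k (y ++ instance [:: None] (map inr w)) (y ++ map inr w).
Proof.
elim: w y => [|s w IHw] y kP.
  by apply: bounded_derives_refl; rewrite nb_variables_cat; lia.
set x := instance _ _ in kP *.
have xE : x = instance [:: None] [:: inr s] ++ instance [:: None] (map inr w).
  by rewrite -instance_cat.
rewrite {x}xE nb_variables_cat in kP *.
rewrite -[map _ (s :: w)]/([:: inr s] ++ map inr w).
apply: (@bounded_derives_trans _ _ _
    (y ++ [:: inr s] ++ instance [:: None] (map inr w))); last first.
  rewrite !catA; apply: IHw; rewrite nb_variables_cat; apply: leq_trans kP.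
  by rewrite -addnA leq_add2l leq_addl.
have kP' : nb_variables (y ++ [:: inr s] ++ instance [:: None] (map inr w)) <= k.
  by rewrite !nb_variables_cat; apply: leq_trans kP; rewrite leq_add2l leq_addl.
move: kP; set x := instance _ [:: inr s].
have : x = if @active _ E (inr s) then [:: inl (Some (Some (inr s)), [:: None])]
           else [:: inr s] by rewrite /x /instance /=; case: ifP.
case: ifP => _ -> kP; last exact: bounded_derives_refl.
apply: bounded_derives_step (bounded_derives_refl kP').
  by rewrite !nb_variables_cat; lia.
apply: (@IndPop _ sim_grammar _ _ _ _ _ [:: inr s]).
by rewrite mem_cat; apply/orP; left; apply/mapP; exists s; rewrite ?mem_enum.
Qed.

Lemma sim_derivation k x s w :
  derivation (@et0l_step _ E) x s -> last x s = map inr w ->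
  all (fun y => count (@active _ E) y <= k) (x :: s) ->
  exists ts, bounded_derives k.*2
    (instance (rcons (map some ts) None) x) (map inr w).
Proof.
have nb z y : derivation (@et0l_step _ E) z y -> last z y = map inr w ->
    forall alpha, nb_variables (instance alpha z) = count (@active _ E) z.
  move=> dz lz alpha; apply: nb_variables_sim => a za; apply/negPn/negP => a_in.
  have := inactive_derivation a_in dz za; rewrite lz.
  by case/mapP.
elim: s x => [|y s IHs] x /= => [_ ->|[xy ds] ls].
  rewrite andbT => kw; exists [::].
  apply: (@sim_bottom _ _ [::]).
  by rewrite (nb (map inr w) [::]) //=; lia.
case/and3P=> kx ky ks.
have [|ts dts] := IHs y ds ls; first by rewrite /= ky.
have nbx := nb x (y :: s) (conj xy ds) ls.
have nby := nb y s ds ls.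
case: xy => t tE [ys ty yE]; exists (SeqSub tE :: ts) => /=.
apply: bounded_derives_trans dts.
rewrite yE in nby ky *.
apply: (@sim_step _ (SeqSub tE) _ x ys [::]) => //.
by rewrite nbx nby add0n -addnn leq_add.
Qed.

End IndexedOfET0L.

Lemma ET0L_FIN_IND_FIN (Sigma : finType) (L : language Sigma) :
  ET0L_FIN L -> IND_FIN L.
Proof.
case=> E [k [Ek LE]].
(* The successor leaves room for the single variable of the guessing phase when [k] is 0. *)
apply: (@IND_FIN_intro _ _ (sim_grammar E) k.*2.+1) => // u.
  by move/sim_grammar_sound/LE.
move=> /LE/Ek[s [[ds ls] ks]].
have [ts] := sim_derivation ds ls ks.
set x := instance _ _ => -[s' [ds' ls' ks']].
suff : bounded_derives k.*2.+1 (ind_axiom (sim_grammar E)) x.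
  move/bounded_derives_trans; apply; exists s'; split=> //.
  by apply: sub_all ks' => y; apply: leqW.
have x1 : nb_variables x <= k.*2.+1.
  by case/andP: ks' => kx _; apply: leqW.
apply: bounded_derives_step => //.
  by apply: (@IndPush _ (sim_grammar E) [::] [::]); apply: mem_head.
move: x1; rewrite /x {s' ds' ls' ks' x} => x1.
apply: (@bounded_derives_trans _ (sim_grammar E) _
    [:: inl (Some None, rcons (map some ts) None)]); last first.
  apply: bounded_derives_step (bounded_derives_refl x1) => //.
  rewrite -[instance _ _]cats0.
  by apply: (@IndPlain _ (sim_grammar E) [::] [::] _ _
      [:: sim_letter (et0l_axiom E)]); apply: mem_head.
(* The tables are pushed in reverse order, so that the first one to be applied ends on top. *)
elim: ts {x1} => [|t ts IHts] /=; first exact: bounded_derives_refl.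
apply: (bounded_derives_trans IHts).
apply: bounded_derives_step (bounded_derives_refl _) => //.
apply: (@IndPush _ (sim_grammar E) [::] [::]).
by rewrite in_cons; apply/orP; right; apply: map_f; rewrite mem_enum.
Qed.

(** * The Dyck language *)

(* [(true, c)] is the opening and [(false, c)] the closing bracket of type
   [c]; [s] is the stack of the types of the pending opening brackets. *)
Definition bracket : finType := (bool * bool)%type.

Fixpoint run (s : seq bool) (w : seq bracket) : option (seq bool) :=
  match w with
  | [::] => Some s
  | (true, c) :: w' => run (c :: s) w'
  | (false, c) :: w' =>
      if s is d :: s' then if c == d then run s' w' else None else None
  end.

Definition dyck : language bracket := fun w => run [::] w = Some [::].

(** The index word is the stack of a pushdown automaton. A push production emits no terminal, so
    [Some (Some c)] remembers that [c] has just been pushed and its opening bracket must still be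
    written. *)
Definition dyck_grammar : indexed_grammar bracket :=
  @IndexedGrammar bracket (option (option bool)) (option bool) None
    [seq (Some (Some c), [:: inr (true, c); inl (Some None)]) | c <- enum {: bool}]
    ((None, Some None, None) ::
     [seq (Some None, Some (Some c), Some c) | c <- enum {: bool}])
    ((Some None, None, [::]) ::
     [seq (Some None, Some c, [:: inr (false, c); inl (Some None)])
        | c <- enum {: bool}]).

Definition dyck_sem (p : option (option bool) * seq (option bool))
    (v : seq bracket) : Prop :=
  match p.1 with
  | None => dyck v
  | Some None => run (until_bottom p.2) v = Some [::]
  | Some (Some c) =>
      exists2 v', v = (true, c) :: v' & run (until_bottom p.2) v' = Some [::]
  end.

Lemma dyck_grammar_sound u : ind_language dyck_grammar u -> dyck u.
Proof.
apply: (@ind_language_sem _ dyck_grammar dyck_sem) => /=.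
- move=> A alpha nu v /mapP[c _ [-> ->]] /=.
  by move=> [v1 [v2 [-> -> [v3 [v4 [-> v3r ->]]]]]]; exists v3; rewrite ?cats0.
- move=> A B f alpha v; rewrite in_cons => /predU1P[[-> -> ->] //|].
  by move=> /mapP[c _ [-> -> ->]] /= [v' -> v'r].
- move=> A f alpha nu v; rewrite in_cons => /predU1P[[-> -> ->] /= -> //|].
  move=> /mapP[c _ [-> -> ->]] /= [v1 [v2 [-> -> [v3 [v4 [-> v3r ->]]]]]].
  by rewrite cats0 /dyck_sem /= eqxx.
Qed.

Lemma dyck_grammar_run s v w : run s w = Some [::] ->
  bounded_derives (G := dyck_grammar) 1
    (map inr v ++ [:: inl (Some None, rcons (map some s) None)])
    (map inr (v ++ w)).
Proof.
have nb1 v1 p : @nb_variables _ dyck_grammar (map inr v1 ++ [:: inl p]) <= 1.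
  by rewrite nb_variables_cat nb_variables_word.
elim: w s v => [|[[] c] w IHw] s v /=.
- case=> ->; apply: bounded_derives_step => //; last first.
    by apply: bounded_derives_refl; rewrite nb_variables_word.
  rewrite cats0 -[X in ind_step _ X]cats0.
  by apply: (@IndPop _ dyck_grammar _ [::] _ _ _ [::]); apply: mem_head.
- move=> /(IHw _ (rcons v (true, c))); rewrite cat_rcons map_rcons cat_rcons.
  move=> vw; apply: bounded_derives_step (bounded_derives_step _ _ vw) => //.
    apply: (@IndPush _ dyck_grammar _ [::] _ (Some (Some c)) (Some c)).
    by rewrite in_cons; apply/orP; right; apply: map_f; rewrite mem_enum.
  exact: nb1.
  apply: (@IndPlain _ dyck_grammar _ [::] _ _ [:: inr (true, c); inl (Some None)]).
  by apply: map_f; rewrite mem_enum.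
- case: s => // d s; case: eqP => // <- /(IHw _ (rcons v (false, c))).
  rewrite cat_rcons map_rcons cat_rcons; apply: bounded_derives_step => //.
  apply: (@IndPop _ dyck_grammar _ [::] _ _ _ [:: inr (false, c); inl (Some None)]).
  by rewrite in_cons; apply/orP; right; apply: map_f; rewrite mem_enum.
Qed.

Lemma dyck_IND_FIN : IND_FIN dyck.
Proof.
apply: (@IND_FIN_intro _ _ dyck_grammar 1) => //.
  exact: dyck_grammar_sound.
move=> u /(@dyck_grammar_run _ [::]); apply: bounded_derives_step => //.
by apply: (@IndPush _ dyck_grammar [::] [::]); apply: mem_head.
Qed.

(** * Runs on nested blocks of brackets *)

Lemma run_cat s w1 w2 : run s (w1 ++ w2) = obind (run^~ w2) (run s w1).
Proof.
elim: w1 s => [|[[] c] w1 IHw] s //=.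
by case: s => // d s; case: eqP => // _; rewrite IHw.
Qed.

(* The positions of the opening brackets alone determine which part of the
   stack is read. *)
Lemma run_shape w0 w s0 t0 s1 s t : map fst w = map fst w0 ->
  run s0 w0 = Some t0 -> size s1 = size s0 -> run (s1 ++ s) w = Some t ->
  exists2 t1, t = t1 ++ s & size t1 = size t0.
Proof.
elim: w0 w s0 s1 => [|[b0 c0] w0 IHw] [|[b c] w] s0 s1 //=.
  by move=> _ [<-] ? [<-]; exists s1.
move=> [-> ww]; case: b0 => [r0 s10 r|].
  by apply: (IHw w (c0 :: s0) (c :: s1) ww r0 _ r); rewrite /= s10.
case: s0 s1 => // d0 s0 [|d s1] //=.
by case: eqP => // _ r0 [s10]; case: eqP => // _; apply: (IHw w s0 s1 ww r0 s10).
Qed.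

Definition opening (u : seq bool) : seq bracket := map (pair true) u.
Definition closing (u : seq bool) : seq bracket := map (pair false) (rev u).

Lemma run_opening s u : run s (opening u) = Some (rev u ++ s).
Proof.
by elim: u s => //= c u IHu s; rewrite IHu rev_cons cat_rcons.
Qed.

Lemma run_closing s u t : run s (closing u) = Some t -> s = rev u ++ t.
Proof.
rewrite /closing; elim: (rev u) s => [|c v IHv] [|d s] //=; first by case.
  by case.
by case: eqP => // -> /IHv ->.
Qed.

Lemma run_closing_rev s u : run (rev u ++ s) (closing u) = Some s.
Proof. by rewrite /closing; elim: (rev u) => //= c v IHv; rewrite eqxx. Qed.

(** Having the shape of a Dyck word, [y] leaves the stack below it untouched, so [closing v] must
    pop exactly what [opening u] pushed. *)
Lemma dyck_block_inj p q y0 y u v : size u = size v ->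
  dyck y0 -> map fst y = map fst y0 ->
  dyck (p ++ opening u ++ y ++ closing v ++ q) -> u = v.
Proof.
rewrite /dyck => uv y0D yy; rewrite run_cat; case: (run _ p) => //= s.
rewrite run_cat run_opening /= run_cat.
case ry: (run _ y) => [t|] //=.
have [[|//] tE _] := run_shape (s1 := [::]) yy y0D erefl ry.
rewrite run_cat; case rc: (run t _) => [t'|] //= _.
have /eqP := run_closing rc; rewrite tE /= eqseq_cat ?size_rev //.
by case/andP=> /eqP/(congr1 rev); rewrite !revK.
Qed.

Fixpoint tree h u : seq bracket :=
  opening u ++
  (if h is h'.+1 then tree h' u ++ tree h' u ++ tree h' u else [::]) ++
  closing u.

Definition branches h u :=
  if h is h'.+1 then tree h' u ++ tree h' u ++ tree h' u else [::].

Lemma treeE h u : tree h u = opening u ++ branches h u ++ closing u.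
Proof. by case: h. Qed.

Lemma run_tree h u s : run s (tree h u) = Some s.
Proof.
elim: h s => [|h IHh] s /=; rewrite run_cat run_opening /=.
  exact: run_closing_rev.
by rewrite -!catA !run_cat IHh /= !run_cat IHh /= !run_cat IHh /= run_closing_rev.
Qed.

Lemma run_branches h u s : run s (branches h u) = Some s.
Proof.
by case: h => //= h; rewrite run_cat run_tree /= run_cat run_tree /= run_tree.
Qed.

Fixpoint tree_size n h :=
  n +
  ((if h is h'.+1 then tree_size n h' + (tree_size n h' + tree_size n h')
    else 0) + n).

Lemma size_opening u : size (opening u) = size u.
Proof. by rewrite size_map. Qed.

Lemma size_closing u : size (closing u) = size u.
Proof. by rewrite size_map size_rev. Qed.

Lemma size_tree h u : size (tree h u) = tree_size (size u) h.
Proof.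
by elim: h => [|h IHh] /=; rewrite !size_cat size_opening size_closing ?IHh.
Qed.

(** Linearity in the block length, at fixed height, is what keeps the number of codes polynomial. *)
Lemma tree_sizeM n h : tree_size n h = n * tree_size 1 h.
Proof. by elim: h => [|h /= ->]; rewrite /=; lia. Qed.

Lemma shape_opening u : map fst (opening u) = nseq (size u) true.
Proof. by elim: u => //= c u ->. Qed.

Lemma shape_closing u : map fst (closing u) = nseq (size u) false.
Proof. by rewrite /closing -(size_rev u); elim: (rev u) => //= c v ->. Qed.

Lemma shape_tree h u v : size u = size v ->
  map fst (tree h u) = map fst (tree h v).
Proof.
move=> uv; elim: h => [|h IHh] /=;
  by rewrite !map_cat ?IHh !shape_opening !shape_closing uv.
Qed.

(** * Sweeping a complete ternary tree *)

Fixpoint changes_from (b : bool) (s : seq bool) : nat :=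
  if s is b' :: s' then (b != b') + changes_from b' s' else 0.

(** Starting from the head of [s] makes the first comparison void. *)
Definition changes (s : seq bool) := changes_from (head true s) s.

Lemma changes_from_cat b s1 s2 : changes_from b (s1 ++ s2) =
  changes_from b s1 + changes_from (last b s1) s2.
Proof. by elim: s1 b => //= b' s1 IHs b; rewrite IHs addnA. Qed.

Lemma leq_changes b s : changes s <= changes_from b s.
Proof. by case: s => //= b' s; rewrite /changes /= eqxx leq_addl. Qed.

Lemma leq_changes_cat s1 s2 : changes s1 + changes s2 <= changes (s1 ++ s2).
Proof.
case: s1 => // b s1; rewrite /changes /= eqxx changes_from_cat /= !add0n.
by rewrite leq_add2l leq_changes.
Qed.

Lemma changes_eq0 s b : b \in s -> changes s = 0 -> s = nseq (size s) b.
Proof.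
suff H b' r : changes_from b' r = 0 -> r = nseq (size r) b'.
  move=> bs /H; case: s bs => //= b' s bs sE.
  by move: bs; rewrite sE -[_ :: nseq _ _]/(nseq (size s).+1 b') mem_nseq => /eqP ->.
elim: r b' => //= c r IHr b' /eqP; rewrite addn_eq0 eqb0 negbK.
by case/andP=> /eqP <- /eqP/IHr <-.
Qed.

Lemma changes_gt0 s : true \in s -> false \in s -> 0 < changes s.
Proof.
move=> ts fs; rewrite lt0n; apply/eqP => /(changes_eq0 ts) sE.
by move: fs; rewrite sE mem_nseq andbF.
Qed.

Lemma changes_gt0_mem s b : 0 < changes s -> b \in s.
Proof.
move=> s0; apply/negPn/negP => bs.
have sE : s = nseq (size s) (~~ b).
  elim: s bs {s0} => //= c s IHs; rewrite in_cons negb_or => /andP[bc /IHs <-].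
  by congr (_ :: _); move: bc; case: (b); case: c.
have C c k : changes_from c (nseq k c) = 0 by elim: k => //= k ->; rewrite eqxx.
move: s0; rewrite sE; case: (size s) => // k.
by rewrite /changes -[head _ _]/(~~ b) C.
Qed.

(* [a] is the offset, in the word [tree h u] with [size u = n], of a subtree of
   height [h']. *)
Inductive subtree (n : nat) : nat -> nat -> nat -> Prop :=
| SubtreeRefl h : subtree n h 0 h
| SubtreeChild h i a h' of i < 3 & subtree n h a h' :
    subtree n h.+1 (n + i * tree_size n h + a) h'.

(** The length [b] of the remainder is chosen before [u], so that the trees of two blocks of equal
    length split at the same places. *)
Lemma subtreeP n h a h' : subtree n h a h' ->
  exists b, forall u, size u = n -> exists p q,
    [/\ tree h u = p ++ tree h' u ++ q, size p = a & size q = b].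
Proof.
elim=> [{}h|{a h'} {}h i a h' i3 _ [b IH]].
  by exists 0 => u _; exists [::], [::]; rewrite cats0.
exists ((2 - i) * tree_size n h + b + n) => u un.
have [p [q [E pa qb]]] := IH u un.
have sT : size (tree h u) = tree_size n h by rewrite size_tree un.
case: i i3 => [|[|[|//]]] _ /=.
- exists (opening u ++ p), (q ++ tree h u ++ tree h u ++ closing u).
  rewrite {1}E !size_cat size_opening size_closing sT un -!catA.
  by split=> //; rewrite ?pa ?qb; lia.
- exists (opening u ++ tree h u ++ p), (q ++ tree h u ++ closing u).
  rewrite {2}E !size_cat size_opening size_closing sT un -!catA.
  by split=> //; rewrite ?pa ?qb; lia.
- exists (opening u ++ tree h u ++ tree h u ++ p), (q ++ closing u).
  rewrite {3}E !size_cat size_opening size_closing sT un -!catA.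
  by split=> //; rewrite ?pa ?qb; lia.
Qed.

Section TreeSweep.
(** [f i p] means that position [p] is finished at time [i]; times run from 0 to [m], [n] is the
    block length and [N] the length of the word. *)
Variables (f : nat -> nat -> bool) (m n N : nat).
Hypothesis n_gt0 : 0 < n.
Hypothesis f_mono : forall i j p, i <= j <= m -> f i p -> f j p.

Definition segment i o len := map (f i) (iota o len).

Hypothesis f_leaf : forall o, o + n.*2 <= N ->
  exists2 i, i <= m & 0 < changes (segment i o n.*2).

Definition cut i o h := exists b,
  segment i o n = nseq n b /\
  segment i (o + (tree_size n h - n)) n = nseq n (~~ b).

Lemma segment_cat i o len1 len2 :
  segment i o (len1 + len2) = segment i o len1 ++ segment i (o + len1) len2.
Proof. by rewrite /segment iotaD map_cat. Qed.

Lemma mem_segment i o len p : o <= p < o + len -> f i p \in segment i o len.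
Proof. by move=> op; apply: map_f; rewrite mem_iota. Qed.

Lemma segmentP i o len b : b \in segment i o len ->
  exists2 p, o <= p < o + len & f i p = b.
Proof. by case/mapP=> p; rewrite mem_iota => op ->; exists p. Qed.

Lemma size_segment i o len : size (segment i o len) = len.
Proof. by rewrite size_map size_iota. Qed.

(** If one of the outer parts is not constant, its changes add to those of the middle part. If both
    are constant, [p] and [p'] lie in different ones, which therefore have opposite values, and the
    extreme blocks form a cut. *)
Lemma segment_mixed t o l c r p p' :
  n <= l -> n <= r -> 0 < changes (segment t (o + l) c) ->
  o <= p < o + (l + (c + r)) -> ~~ (o + l <= p < o + l + c) -> f t p ->
  o <= p' < o + (l + (c + r)) -> ~~ (o + l <= p' < o + l + c) -> ~~ f t p' ->
  changes (segment t (o + l) c) < changes (segment t o (l + (c + r))) \/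
  exists b, segment t o n = nseq n b /\
    segment t (o + (l + (c + r) - n)) n = nseq n (~~ b).
Proof.
move=> nl nr _ pI pO fp p'I p'O fp'.
rewrite !segment_cat.
set L := segment t o l; set R := segment t (o + l + c) r.
have := leq_trans (leq_add (leqnn _) (leq_changes_cat _ _))
  (leq_changes_cat L (segment t (o + l) c ++ R)).
have [|] := posnP (changes L + changes R); last by left; lia.
move/eqP; rewrite addn_eq0 => /andP[/eqP L0 /eqP R0] _; right.
have LE : L = nseq l (f t o).
  rewrite -[in RHS](size_segment t o l); apply: changes_eq0 => //.
  by apply: mem_segment; lia.
have RE : R = nseq r (f t (o + l + c)).
  rewrite -[in RHS](size_segment t (o + l + c) r); apply: changes_eq0 => //.
  by apply: mem_segment; lia.
have Lp q : o <= q < o + l -> f t q = f t o.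
  by move=> qI; have := mem_segment t qI; rewrite -/L LE mem_nseq => /andP[_ /eqP].
have Rp q : o + l + c <= q < o + l + c + r -> f t q = f t (o + l + c).
  by move=> qI; have := mem_segment t qI; rewrite -/R RE mem_nseq => /andP[_ /eqP].
have LRp q : o <= q < o + (l + (c + r)) -> ~~ (o + l <= q < o + l + c) ->
    f t q = f t o \/ f t q = f t (o + l + c).
  move=> q1 q2; have [ql|lq] := ltnP q (o + l); first by left; apply: Lp; lia.
  by right; apply: Rp; lia.
exists (f t o); split.
  move: LE; rewrite /L -(subnKC nl) segment_cat nseqD => /eqP.
  by rewrite eqseq_cat ?size_segment ?size_nseq // => /andP[/eqP].
have -> : ~~ f t o = f t (o + l + c).
  have := LRp p pI pO; have := LRp p' p'I p'O; rewrite fp (negbTE fp').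
  by case: (f t o); case: (f t (o + l + c)) => // -[] // _ [].
move: RE; rewrite /R -(subnK nr) segment_cat nseqD => /eqP.
rewrite eqseq_cat ?size_segment ?size_nseq // => /andP[_ /eqP <-].
by congr (segment _ _ _); lia.
Qed.

(* Each child [j] is mixed at some time [t j].  At the middle one of the three
   times, one of the other two children has a finished position and the other
   one an unfinished position. *)
Lemma tree_sweep h o : o + tree_size n h <= N ->
  (exists i a h', [/\ i <= m, subtree n h a h' & cut i (o + a) h']) \/
  (exists2 i, i <= m & h < changes (segment i o (tree_size n h))).
Proof.
elim: h o => [|h IHh] o /= oN.
  by right; rewrite add0n addnn; apply: f_leaf; lia.
set T := tree_size n h in IHh oN *.
have child j : j < 3 ->
    (exists i a h', [/\ i <= m, subtree n h.+1 a h' & cut i (o + a) h']) \/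
    (exists2 i, i <= m & h < changes (segment i (o + (n + j * T)) T)).
  move=> j3; have [|[i [a [h' [im sub ci]]]]|] := IHh (o + (n + j * T)).
  - by case: j j3 => [|[|[|//]]] _; lia.
  - left; exists i, (n + j * T + a), h'; split=> //; last by rewrite addnA.
    exact: SubtreeChild.
  - by right.
have [//|[t0 m0 c0]] := child 0 isT; first by left.
have [//|[t1 m1 c1]] := child 1 isT; first by left.
have [//|[t2 m2 c2]] := child 2 isT; first by left.
have mid j j1 j2 t s1 s2 : j < 3 -> j1 < 3 -> j2 < 3 -> j1 != j -> j2 != j ->
    s1 <= t <= m -> t <= s2 <= m ->
    h < changes (segment t (o + (n + j * T)) T) ->
    h < changes (segment s1 (o + (n + j1 * T)) T) ->
    h < changes (segment s2 (o + (n + j2 * T)) T) ->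
    (exists i a h', [/\ i <= m, subtree n h.+1 a h' & cut i (o + a) h']) \/
    (exists2 i, i <= m & h.+1 < changes (segment i o (n + (T + (T + T) + n)))).
  move=> j3 j13 j23 j1j j2j s1t ts2 cj cj1 cj2.
  (* By monotonicity, a position of child [j1] finished at [s1] is still finished at [t], and one of
     child [j2] unfinished at [s2] is unfinished at [t]. *)
  have [p p1 /(f_mono s1t) fp] :=
    segmentP (changes_gt0_mem true (leq_ltn_trans (leq0n _) cj1)).
  have [p' p'1 fp'] :=
    segmentP (changes_gt0_mem false (leq_ltn_trans (leq0n _) cj2)).
  have nfp' : ~~ f t p' by apply: contraFN fp'; apply: f_mono.
  have jT : j1 * T + T <= j * T \/ j * T + T <= j1 * T by nia.
  have jT' : j2 * T + T <= j * T \/ j * T + T <= j2 * T by nia.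
  have jT3 : j * T + T <= 3 * T by nia.
  have j1T3 : j1 * T + T <= 3 * T by nia.
  have j2T3 : j2 * T + T <= 3 * T by nia.
  have lenE : n + (T + (T + T) + n) = (n + j * T) + (T + ((2 - j) * T + n)) by nia.
  have [||||||lt|cb] := @segment_mixed t o (n + j * T) T ((2 - j) * T + n) p p'
    _ _ (leq_ltn_trans (leq0n _) cj) _ _ fp _ _ nfp'; try lia.
  - by right; exists t; [lia | rewrite lenE; lia].
  - left; exists t, 0, h.+1; split; [lia | exact: SubtreeRefl |].
    case: cb => b [b1 b2]; exists b; rewrite addn0; split=> //.
    by rewrite -b2 /= -/T lenE.
(* All orders of the three times; two of the eight cases are contradictory. *)
have [le01|lt10] := leqP t0 t1; have [le12|lt21] := leqP t1 t2;
  have [le02|lt20] := leqP t0 t2.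
- by apply: (mid 1 0 2 t1 t0 t2); lia.
- lia.
- by apply: (mid 2 0 1 t2 t0 t1); lia.
- by apply: (mid 0 2 1 t0 t2 t1); lia.
- by apply: (mid 0 1 2 t0 t1 t2); lia.
- by apply: (mid 2 1 0 t2 t1 t0); lia.
- lia.
- by apply: (mid 1 2 0 t1 t2 t0); lia.
Qed.

End TreeSweep.

Lemma count_nth (T : Type) (x0 : T) (P : pred T) s :
  count P s = count (fun p => P (nth x0 s p)) (iota 0 (size s)).
Proof. by rewrite -[in LHS](mkseq_nth x0 s) count_map; apply: eq_count. Qed.

Lemma leq_count_iota (P : pred nat) o len N : o + len <= N ->
  count P (iota o len) <= count P (iota 0 N).
Proof.
move=> /subnKC <-; rewrite -addnA iotaD iotaD !count_cat add0n; lia.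
Qed.

(** At the end too few positions are unfinished to fill the window, so there is a first time at
    which it has a finished position. It is then mixed, since a single step finishes at most [c < n]
    positions. *)
Lemma leaf_mixed (f : nat -> nat -> bool) m N c n o :
  (forall p, p < N -> ~~ f 0 p) ->
  count (fun p => ~~ f m p) (iota 0 N) < n ->
  (forall i, i < m -> count (fun p => ~~ f i p && f i.+1 p) (iota 0 N) <= c) ->
  c < n -> o + n <= N ->
  exists2 i, i <= m & 0 < changes (segment f i o n).
Proof.
move=> f0 fm fS cn oN.
have full P : all P (iota o n) -> n <= count P (iota 0 N).
  by rewrite all_count size_iota => /eqP {1}<-; apply: leq_count_iota.
have ntrue i p : true \notin segment f i o n -> p \in iota o n -> ~~ f i p.
  rewrite mem_iota => nt op; apply: contra nt => fp.
  by rewrite -fp; apply: mem_segment.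
have mP : exists i, true \in segment f i o n.
  exists m; apply/negPn/negP => nt; move: fm; apply/negP; rewrite -leqNgt.
  by apply: full; apply/allP => p; apply: ntrue.
have [[|i] it imin] := ex_minnP mP.
  have [p op fp] := segmentP it.
  by have := f0 p; rewrite fp => /(_ _)/negP; case=> //; lia.
have im : i < m.
  rewrite ltnNge; apply/negP => mi; move: fm; apply/negP; rewrite -leqNgt.
  apply: full; apply/allP => p; apply: ntrue; apply/negP => /imin; lia.
have nti : true \notin segment f i o n by apply/negP => /imin; rewrite ltnn.
exists i.+1 => //; apply: changes_gt0 => //; apply/negPn/negP => nf.
have : n <= c; last by rewrite leqNgt cn.
apply: leq_trans (fS i im); apply: full; apply/allP => p op.
rewrite (ntrue _ _ nti op) /=; apply/negPn/negP => fp; move/negP: nf; apply.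
by rewrite -(negbTE fp); apply: mem_segment; rewrite -mem_iota.
Qed.

(** * Exponential against polynomial growth *)

Lemma exp_beats_linear a b m0 : exists2 m, m0 <= m & a * m + b < 2 ^ m.
Proof.
pose j := 2 * a + b + m0; exists (j + j); first by rewrite /j; lia.
have /leq_mul := ltn_expl j (isT : 1 < 2).
move=> /(_ _ _ (ltn_expl j (isT : 1 < 2))); rewrite -expnD.
by apply: leq_trans; rewrite /j; nia.
Qed.

(** For [n] of the form [2 ^ m] the left-hand side is at most 2 to a power linear in [m], so only
    exponents have to be compared. *)
Lemma exp_beats_poly a b d e n0 : exists2 n,
  n0 <= n & ((a * n + b) * (d * (a * n + b)).+1) ^ e.+1 < 2 ^ n.
Proof.
have [m m0 mP] := exp_beats_linear (2 * e.+1) ((2 * (a + b) + d.+1) * e.+1) n0.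
exists (2 ^ m); first by apply: ltnW; apply: leq_ltn_trans m0 (ltn_expl _ _).
apply: leq_ltn_trans (_ : 2 ^ (2 * e.+1 * m + (2 * (a + b) + d.+1) * e.+1) < _);
  last by rewrite ltn_exp2l.
have -> : 2 * e.+1 * m + (2 * (a + b) + d.+1) * e.+1 =
  ((a + b + m) + (d.+1 + (a + b + m))) * e.+1 by lia.
rewrite expnM leq_exp2r //.
have X : a * 2 ^ m + b <= 2 ^ (a + b + m).
  rewrite [leqRHS]expnD; have := ltn_expl (a + b) (isT : 1 < 2).
  have : 0 < 2 ^ m by rewrite expn_gt0.
  by move: (2 ^ m) (2 ^ (a + b)) => y z; nia.
rewrite expnD; apply: leq_mul => //; rewrite expnD.
have := ltn_expl d.+1 (isT : 1 < 2).
have : 0 < 2 ^ (a + b + m) by rewrite expn_gt0.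
by move: X; move: (2 ^ (a + b + m)) (2 ^ d.+1) (a * _ + b) => x y z; nia.
Qed.

Definition newly (q : bool * bool) := ~~ q.1 && q.2.

Lemma all2_implb_false s : all2 implb (nseq (size s) false) s.
Proof. by elim: s. Qed.

Lemma count_newly_false s : count newly (zip (nseq (size s) false) s) = count id s.
Proof. by elim: s => //= b s ->. Qed.

Lemma all2_implb_refl s : all2 implb s s.
Proof. by elim: s => //= b s ->; rewrite implybb. Qed.

Lemma count_newly_refl s : count newly (zip s s) = 0.
Proof. by elim: s => //= b s ->; case: b. Qed.

(** * Derivations of ET0L systems as sweeps *)

Section Trace.
Variables (Sigma : finType) (E : et0l_system Sigma).
Notation letter := (et0l_letter E).
Notation form := (et0l_form E).
Notation table := (seq_sub (et0l_tables E)).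
Implicit Types (x y z : form) (a : letter) (ts : seq table).
Implicit Types (l : seq (letter * seq Sigma)).

(* A form of a derivation of a terminal word, each letter being paired with the
   factor of that word which it yields. *)
Definition yields ts l :=
  forall p, p \in l -> derives ts [:: p.1] (map inr p.2).

Definition word l : seq Sigma := flatten (map snd l).

(* A position of the word is finished when the letter that yields it is
   inactive, hence is a terminal that no table can change. *)
Definition status l : seq bool :=
  flatten [seq nseq (size p.2) (~~ active p.1) | p <- l].

Lemma yields_cat ts l1 l2 : yields ts (l1 ++ l2) <-> yields ts l1 /\ yields ts l2.
Proof.
split=> [l12|[l1P l2P] p]; last by rewrite mem_cat => /orP[/l1P|/l2P].
by split=> p pl; apply: l12; rewrite mem_cat pl ?orbT.
Qed.

Lemma yields_derives ts l : yields ts l ->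
  derives ts (map fst l) (map inr (word l)).
Proof.
move=> lP; rewrite map_flatten -map_comp.
have -> : map fst l = flatten (map (fun p => [:: p.1]) l).
  by elim: l {lP} => //= p l ->.
exact: derives_flatten.
Qed.

Lemma size_status l : size (status l) = size (word l).
Proof. by elim: l => //= p l IHl; rewrite !size_cat size_nseq IHl. Qed.

Lemma size_inactive ts l p : yields ts l -> p \in l -> ~~ active p.1 ->
  map inr p.2 = [:: p.1].
Proof. by move=> lP /lP pP p_in; apply: derives_inactive pP. Qed.

Lemma count_status ts l : yields ts l -> count id (status l) <= size l.
Proof.
elim: l => //= p l IHl pl; rewrite count_cat count_nseq.
have /yields_cat[_ /IHl] := pl : yields ts ([:: p] ++ l).
case: (boolP (active p.1)) => [_|p_in] /=; first by rewrite mul0n => /leqW.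
have /(congr1 size) := size_inactive pl (mem_head _ _) p_in.
by rewrite size_map mul1n => ->.
Qed.

(** Each active letter contributes one block of unfinished positions, hence at most two changes;
    [~~ b] pays for leaving an unfinished start. *)
Lemma changes_status b l :
  changes_from b (status l) <= (count (@active _ E) (map fst l)).*2 + ~~ b.
Proof.
have run_changes e d k r :
    changes_from e (nseq k.+1 d ++ r) = (e != d) + changes_from d r.
  by rewrite /=; congr (_ + _); elim: k => //= k ->; rewrite eqxx.
elim: l b => // p l IHl b; rewrite [status _]/(_ ++ status l) [map _ _]/=.
rewrite [count _ _]/=; case: (size p.2) => [|k].
  by have := IHl b; rewrite /=; lia.
rewrite run_changes; have := IHl (~~ active p.1).
by case: b; case: active; rewrite ?eqxx /=; lia.
Qed.

Variable c : nat.
Hypothesis rule_size : forall (t : table) a alpha,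
  (a, alpha) \in ssval t -> size alpha <= c.

(** The trace of one step on positions: an active letter is replaced by at most [c] letters, so it
    releases at most [c] finished positions. *)
Definition sweeps l l1 := all2 implb (status l) (status l1) &&
  (count newly (zip (status l) (status l1)) <=
   c * count (@active _ E) (map fst l)).

(** Annotations are computed backwards: the factor of a letter is the concatenation of the factors
    of the letters replacing it. *)
Lemma refine_step (t : table) ts x ys l1 :
  all2 (fun a alpha => (a, alpha) \in ssval t) x ys ->
  map fst l1 = flatten ys -> yields ts l1 ->
  exists l, [/\ map fst l = x, yields (t :: ts) l, word l = word l1 & sweeps l l1].
Proof.
elim: x ys l1 => [|a x IHx] [|alpha ys] // l1.
  by case: l1 => // _ _ _; exists [::].
move=> /= /andP[ta tx] l1E l1P.
have [lA [lB [l1AB lAE lBE]]] : exists lA lB,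
    [/\ l1 = lA ++ lB, map fst lA = alpha & map fst lB = flatten ys].
  exists (take (size alpha) l1), (drop (size alpha) l1).
  by rewrite cat_take_drop map_take map_drop l1E take_size_cat ?drop_size_cat.
move: l1P; rewrite l1AB => /yields_cat[lAP lBP].
have [l [lE lP lw /andP[lB1 lB2]]] := IHx ys lB tx lBE lBP.
have aP : derives (t :: ts) [:: a] (map inr (word lA)).
  by apply: derives1 ta _; rewrite -lAE; apply: yields_derives.
have sA : size (nseq (size (word lA)) (~~ active a)) = size (status lA).
  by rewrite size_nseq size_status.
exists ((a, word lA) :: l); split.
- by rewrite /= lE.
- by move=> p; rewrite in_cons => /predU1P[->|/lP].
- by rewrite /word map_cat flatten_cat /= -/(word l) lw.
have stE : status (lA ++ lB) = status lA ++ status lB.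
  by rewrite /status map_cat flatten_cat.
rewrite /sweeps stE /= -/(status l) zip_cat // count_cat mulnDr.
have -> : all2 implb (nseq (size (word lA)) (~~ active a) ++ status l)
    (status lA ++ status lB) =
    all2 implb (nseq (size (word lA)) (~~ active a)) (status lA).
  move: lB1; rewrite !all2E !size_cat zip_cat // all_cat => /andP[/eqP -> ->].
  by rewrite eqn_add2r andbT.
rewrite -size_status; case: (boolP (active a)) sA => [_|a_in] sA.
  rewrite all2_implb_false count_newly_false muln1.
  apply: leq_add lB2; apply: leq_trans (count_status lAP) _.
  by rewrite -(size_map fst) lAE; apply: rule_size ta.
suff -> : status lA = nseq (size (status lA)) true.
  by rewrite size_nseq all2_implb_refl count_newly_refl add0n muln0 add0n.
move: lAE; rewrite (inactive_rule a_in ta); case: (lA) => [|p [|]] //= [pE].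
by rewrite /status /= pE a_in cats0 size_nseq.
Qed.

Lemma derivation_trace x s w :
  derivation (@et0l_step _ E) x s -> last x s = map inr w ->
  exists l0 ls, [/\ map (map fst) (l0 :: ls) = x :: s,
    forall l, l \in l0 :: ls -> word l = w /\ exists ts, yields ts l,
    all (fun p => size p.2 == 1) (last l0 ls) & path sweeps l0 ls].
Proof.
elim: s x => [|y s IHs] x /= => [_ ->|[[t tE [ys tx yE]] ds] ls].
  exists [seq (inr a : letter, [:: a]) | a : Sigma <- w], [::]; split=> //=.
  - by rewrite -map_comp.
  - move=> l; rewrite mem_seq1 => /eqP ->; split.
      by rewrite /word -map_comp flatten_map1 map_id.
    by exists [::] => p /mapP[a _ ->].
  - by apply/allP => p /mapP[a _ ->].
have [l1 [l [lE lP l_last sl]]] := IHs y ds ls.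
case: lE => l1E lE; have [l1w [ts l1P]] := lP l1 (mem_head _ _).
have [|l0 [l0E l0P l0w l01]] := @refine_step (SeqSub tE) ts x ys l1 tx _ l1P.
  by rewrite l1E.
exists l0, (l1 :: l); split=> //=; first by rewrite l0E l1E lE.
  move=> l'; rewrite in_cons => /predU1P[->|/lP //].
  by rewrite l0w l1w; split=> //; exists (SeqSub tE :: ts).
by rewrite l01.
Qed.

End Trace.

(** A cut as a factorization: [s2] covers the branches of the node, and the constant blocks around
    it cover its opening and closing blocks. *)
Definition has_cut n h (s : seq bool) := exists a h' b s1 s2 s3,
  [/\ subtree n h a h', s = s1 ++ nseq n b ++ s2 ++ nseq n (~~ b) ++ s3,
      size s1 = a & n + (size s2 + n) = tree_size n h'].

Lemma subtree_size n h a h' : subtree n h a h' ->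
  exists b, tree_size n h = a + (tree_size n h' + b).
Proof.
move=> /subtreeP[b /(_ (nseq n true) (size_nseq _ _))[p [q [E pa qb]]]].
exists b; have := congr1 size E.
by rewrite !size_cat !size_tree size_nseq pa qb.
Qed.

Lemma derives_trans (Sigma : finType) (E : et0l_system Sigma) ts1 ts2
    (x y z : et0l_form E) :
  derives ts1 x y -> derives ts2 y z -> derives (ts1 ++ ts2) x z.
Proof.
elim: ts1 x => [|t ts1 IHts] x /= => [-> //|[ys ty dy] yz].
by exists ys => //; apply: IHts.
Qed.

Lemma derivation_mem (Sigma : finType) (E : et0l_system Sigma)
    (x y : et0l_form E) s :
  derivation (@et0l_step _ E) x s -> y \in x :: s -> exists ts, derives ts x y.
Proof.
elim: s x => [|z s IHs] x /=; first by rewrite mem_seq1 => _ /eqP ->; exists [::].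
move=> [[t tE [ys ty zE]] ds]; rewrite in_cons => /predU1P[->|].
  by exists [::].
move=> /(IHs _ ds)[ts zy]; exists (SeqSub tE :: ts); exists ys => //.
by rewrite -zE.
Qed.

(** At most [k] active letters allow at most [k.*2] changes, so the sweep of a tree of height [k.*2]
    cannot exceed its height in changes and must meet a cut. The bounds on [n] serve
    [leaf_mixed]. *)
Lemma annotated_cut (E : et0l_system bracket) k c n u s :
  (forall (t : seq_sub (et0l_tables E)) a alpha,
     (a, alpha) \in ssval t -> size alpha <= c) ->
  size u = n -> 0 < n -> k < n.*2 -> c * k < n.*2 ->
  derivation (@et0l_step _ E) (et0l_start E) s ->
  last (et0l_start E) s = map inr (tree k.*2 u) ->
  all (fun x => count (@active _ E) x <= k) (et0l_start E :: s) ->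
  exists l ts1 ts2, [/\ derives ts1 (et0l_start E) (map fst l), yields ts2 l,
    word l = tree k.*2 u, count (@active _ E) (map fst l) <= k &
    has_cut n k.*2 (status l)].
Proof.
move=> rule_size un n_gt0 kn ckn ds ls ks.
have [l0 [r [rE rP r_last l0r]]] := derivation_trace rule_size ds ls.
have rk : all (fun l => count (@active _ E) (map fst l) <= k) (l0 :: r).
  by rewrite -rE all_map in ks.
set h := k.*2 in ls rP *.
pose L i := nth l0 (l0 :: r) i; pose m := size r; pose N := tree_size n h.
have L_in i : i <= m -> L i \in l0 :: r by move=> im; apply: mem_nth.
have Lk i : i <= m -> count (@active _ E) (map fst (L i)) <= k.
  by move=> /L_in/(allP rk).
have sizeL i : i <= m -> size (status (L i)) = N.
  by move=> /L_in/rP[Lw _]; rewrite size_status Lw size_tree un.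
(* Positions beyond the word get the default [true], so that monotonicity holds for every [p]. *)
pose f i p := nth true (status (L i)) p.
have fS i p : i < m -> f i p ==> f i.+1 p.
  move=> im; have /(pathP l0)/(_ i im)/andP[] := l0r.
  rewrite all2E -/(L i) => /andP[/eqP sz + _].
  have [pN|Np] := ltnP p N; last first.
    by move=> _; rewrite /f [X in _ ==> X]nth_default ?implybT // sizeL.
  move/(all_nthP (true, true))/(_ p).
  rewrite size_zip -sz minnn (sizeL i (ltnW im)) => /(_ pN).
  have -> := nth_zip true true p sz.
  by [].
have f_mono i j p : i <= j <= m -> f i p -> f j p.
  elim: j => [|j IHj]; first by rewrite leqn0 => /andP[/eqP ->].
  rewrite leq_eqVlt => /andP[/predU1P[-> //|ij] jm] /IHj fj.
  by apply: (implyP (fS j p jm)); apply: fj; lia.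
have f_leaf o : o + n.*2 <= N ->
    exists2 i, i <= m & 0 < changes (segment f i o n.*2).
  move=> oN; apply: (@leaf_mixed f m N (c * k)) => //.
  (* An inactive axiom would yield a word of length 1, too short to contain a leaf. *)
  - move=> p pN; have [l0w [ts l0P]] := rP _ (mem_head _ _).
    case: rE => l0E _; move: l0E l0P l0w (sizeL 0 isT); rewrite /f /L /=.
    case: (l0) => [|[a v] [|]] //= [->] l0P.
    rewrite /word /status /= !cats0 size_nseq => vE vN.
    case: (boolP (active _)) => [_|a_in]; first by rewrite nth_nseq vN pN.
    have /(congr1 size) := size_inactive l0P (mem_head _ _) a_in.
    by rewrite size_map vN /= => N1; move: oN n_gt0; rewrite N1; lia.
  (* In the last form every letter yields one position, so at most [k] positions are unfinished. *)
  - apply: leq_ltn_trans kn; apply: leq_trans (Lk m (leqnn _)).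
    have Lm : L m = last l0 r by rewrite /L /m -last_nth.
    have statusm : status (L m) = map (fun p => ~~ active p.1) (L m).
      rewrite Lm; elim: (last l0 r) r_last => //= p l IHl /andP[/eqP p1 /IHl].
      by rewrite /status /= p1 => ->.
    rewrite -(sizeL m) // /f -(count_nth true negb) statusm !count_map.
    by apply: sub_count => p /=; rewrite negbK.
  move=> i im; have /(pathP l0)/(_ i im)/andP[_] := l0r.
  rewrite -/(L i) => cL; apply: leq_trans (leq_trans cL _); last first.
    by rewrite leq_mul2l (Lk i (ltnW im)) orbT.
  have e1 := sizeL i (ltnW im).
  have e2 : size (status (nth l0 r i)) = N := sizeL i.+1 im.
  rewrite (count_nth (true, true)) size_zip e1 e2 minnn.
  by apply: sub_count => p; rewrite nth_zip ?e1 ?e2.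
have [] := @tree_sweep f m n N n_gt0 f_mono f_leaf h 0 (leqnn _).
  move=> [i [a [h' [im sub [b [b1 b2]]]]]].
  have [Lw [ts2 Lts]] := rP _ (L_in i im).
  have [ts1 dL] : exists ts1, derives ts1 (et0l_start E) (map fst (L i)).
    by apply: derivation_mem ds _; rewrite -rE; apply: map_f; apply: L_in.
  exists (L i), ts1, ts2; split=> //; first exact: Lk.
  have [d NE] := subtree_size sub.
  have [e hE] : exists e, tree_size n h' = n + (e + n).
    by case: (h') => [|h''] /=; eexists.
  exists a, h', b, (segment f i 0 a), (segment f i (a + n) e),
    (segment f i (a + n + e + n) d).
  rewrite !size_segment; split=> //.
  rewrite add0n in b1 b2; rewrite -b1 -b2.
  have -> : a + (tree_size n h' - n) = a + n + e by rewrite hE; lia.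
  have -> : status (L i) = segment f i 0 N.
    by rewrite /segment -(sizeL i im) -[LHS](mkseq_nth true).
  have -> : N = a + (n + (e + (n + d))) by rewrite /N NE hE; lia.
  by rewrite !segment_cat add0n.
case=> i im; rewrite ltnNge => /negP[].
have -> : segment f i 0 (tree_size n h) = status (L i).
  by rewrite /segment -[tree_size n h](sizeL i im) -[RHS](mkseq_nth true).
apply: leq_trans (leq_changes true _) _; apply: leq_trans (changes_status _ _) _.
by rewrite addn0 leq_double; apply: Lk.
Qed.

(** * The exchange argument *)

Section SparseCode.
Variables (V : finType) (M : nat).

Definition gap : finType := ('I_M.+1 * option (V * 'I_M.+1))%type.

(* A gap [(i, x)] stands for [i] empty slots followed by the optional entry [x];
   sparse sequences thus have polynomially many codes. *)
Definition decode_gap (g : gap) : seq (option (V * nat)) :=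
  nseq g.1 None ++
  (if g.2 is Some am then [:: Some (am.1, am.2 : nat)] else [::]).

Definition decode (c : seq gap) := flatten (map decode_gap c).

Lemma split_first_some (T : Type) (t : seq (option T)) :
  t = nseq (size t) None \/
  exists i x t', t = nseq i None ++ Some x :: t'.
Proof.
elim: t => [|[x|] t IHt]; first by left.
  by right; exists 0, x, t.
case: IHt => [tE|[i [x [t' ->]]]]; first by left; rewrite {1}tE.
by right; exists i.+1, x, t'.
Qed.

(** Besides one gap for each of the at most [k] entries, one more codes the empty slots after the
    last entry; empty gaps pad the tuple. *)
Lemma decodeP k (t : seq (option (V * nat))) :
  size t <= M -> count isSome t <= k ->
  (forall a m, Some (a, m) \in t -> m <= M) ->
  exists c : k.+1.-tuple gap, decode c = t.
Proof.
elim: k t => [|k IHk] t tM tk mM; case: (split_first_some t) => [tE|].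
- exists [tuple (Ordinal (tM : size t < M.+1), None)].
  by rewrite /decode /decode_gap /= !cats0 -tE.
- by move=> [i [x [t' tE]]]; move: tk; rewrite tE count_cat /= addnCA.
- exists (cons_tuple (Ordinal (tM : size t < M.+1), None)
    (nseq_tuple k.+1 (ord0, None))).
  rewrite /decode /= /decode_gap /= cats0 -tE.
  by rewrite [X in _ ++ X](_ : _ = [::]) ?cats0 //; elim: k {IHk tk}.
move=> [i [[a m] [t' tE]]].
have [||b j bj|c' c'E] := IHk t'.
- by move: tM; rewrite tE size_cat /=; lia.
- by move: tk; rewrite tE count_cat /=; lia.
- by apply: (mM b); rewrite tE mem_cat in_cons bj !orbT.
have iM : i < M.+1 by move: tM; rewrite tE size_cat size_nseq /=; lia.
have mM' : m < M.+1 by apply: (mM a); rewrite tE mem_cat in_cons eqxx orbT.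
exists (cons_tuple (Ordinal iM, Some (a, Ordinal mM')) c').
by rewrite /decode /= -/(decode c') c'E tE /decode_gap /= -catA.
Qed.

Lemma card_gap_tuple k :
  #|{: k.-tuple gap}| = (M.+1 * (#|V| * M.+1).+1) ^ k.
Proof. by rewrite card_tuple card_prod card_option card_prod !card_ord. Qed.

End SparseCode.

Section Mix.
Variable T : Type.
Implicit Types (s : seq bool) (w : seq T).

Definition mix s w w' :=
  [seq if q.1 then q.2.1 else q.2.2 | q <- zip s (zip w w')].

Lemma mix_cat s1 s2 w1 w2 w1' w2' : size s1 = size w1 -> size s1 = size w1' ->
  mix (s1 ++ s2) (w1 ++ w2) (w1' ++ w2') = mix s1 w1 w1' ++ mix s2 w2 w2'.
Proof.
move=> sw sw'; rewrite /mix zip_cat -?sw // zip_cat ?map_cat //.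
by rewrite size_zip -sw -sw' minnn.
Qed.

Lemma mix_nseq n b w w' : size w = n -> size w' = n ->
  mix (nseq n b) w w' = if b then w else w'.
Proof.
move=> <-; elim: w w' => [|x w IHw] [|x' w'] //=; first by case: (b).
by case=> /IHw; rewrite /mix /= => ->; case: (b).
Qed.

Lemma map_mix (S : Type) (g : T -> S) s w w' :
  size s = size w -> map g w = map g w' -> map g (mix s w w') = map g w.
Proof.
elim: w s w' => [|x w IHw] [|b s] [|x' w'] //= [sw] [gx /(IHw _ _ sw) gw].
by rewrite /mix /= -/(mix s w w') gw; case: b; rewrite -?gx.
Qed.

End Mix.

Section Swap.
Variables (Sigma : finType) (E : et0l_system Sigma).
Notation letter := (et0l_letter E).
Implicit Types (l : seq (letter * seq Sigma)).

(** Forgetting the inactive letters keeps profiles few; a profile still determines [status], because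
    an inactive letter yields exactly one position. *)
Definition profile l : seq (option (letter * nat)) :=
  [seq if active p.1 then Some (p.1, size p.2) else None | p <- l].

(** Only active letters can yield the empty word. *)
Lemma size_annotated ts l : yields ts l ->
  size l <= size (word l) + count (@active _ E) (map fst l).
Proof.
elim: l => //= p l IHl pl; rewrite size_cat.
have /yields_cat[_ /IHl] := pl : yields ts ([:: p] ++ l).
case: (boolP (active p.1)) => [_|p_in] lP.
  by rewrite add1n addnS ltnS (leq_trans lP) // leq_add2r leq_addl.
have /(congr1 size) := size_inactive pl (mem_head _ _) p_in.
by rewrite size_map => ->; rewrite add0n -addnA add1n ltnS.
Qed.

Lemma profile_decode k M ts l : yields ts l ->
  count (@active _ E) (map fst l) <= k -> size (word l) + k <= M ->
  exists c : k.+1.-tuple (gap letter M), decode c = profile l.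
Proof.
move=> lP lk lM; apply: decodeP.
- rewrite size_map; apply: leq_trans (size_annotated lP) _.
  by apply: leq_trans lM; rewrite leq_add2l.
- rewrite count_map; apply: leq_trans lk; rewrite count_map.
  by apply: sub_count => p /=; case: active.
move=> a m /mapP[p pl]; case: ifP => // _ [_ ->].
apply: leq_trans lM; apply: leq_trans (leq_addr _ _).
elim: l pl {lP lk} => //= q l IHl; rewrite in_cons size_cat.
case/predU1P=> [->|/IHl lp]; first exact: leq_addr.
exact: leq_trans lp (leq_addl _ _).
Qed.

(* [l2] keeps the letters and the finished factors of [l], and takes from [l']
   the yields of the active letters. *)
Lemma swapP ts ts' l l' : profile l = profile l' ->
  yields ts l -> yields ts' l' -> exists l2,
  [/\ map fst l2 = map fst l, yields ts' l2, status l = status l',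
      word l2 = mix (status l) (word l) (word l') &
      size (word l) = size (word l')].
Proof.
elim: l l' => [|[a v] l IHl] [|[a' v'] l'] //.
  by move=> _ _ _; exists [::].
move=> /= pE /(@yields_cat _ _ _ [:: _])[vP lP].
move=> /(@yields_cat _ _ _ [:: _])[vP' lP'].
have [l2 [l2E l2P sE l2w wE]] : exists l2,
  [/\ map fst l2 = map fst l, yields ts' l2, status l = status l',
      word l2 = mix (status l) (word l) (word l') &
      size (word l) = size (word l')].
  by apply: IHl lP lP'; case: pE.
have vv' : size v = size v' /\ active a = active a'.
  case: pE => + _; case: (boolP (active a)) => a_act.
    by case: ifP => // _ [_ ->].
  case: ifPn => // a_in' _; split=> //.
  have /(congr1 size) := size_inactive vP (mem_head _ _) a_act.
  have /(congr1 size) := size_inactive vP' (mem_head _ _) a_in'.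
  by rewrite !size_map /= => -> ->.
exists ((a, if active a then v' else v) :: l2).
have mixE : mix (nseq (size v) (~~ active a)) v v' = if active a then v' else v.
  by rewrite mix_nseq ?if_neg //; case: vv' => ->.
split.
- by rewrite /= l2E.
- apply/(@yields_cat _ _ _ [:: _]); split=> // p; rewrite mem_seq1 => /eqP -> /=.
  case: pE => + _; case: (boolP (active a)) => [a_act|a_in].
    by case: ifP => // _ [aE _]; rewrite aE; apply: (vP' (a', v')); apply: mem_head.
  move=> _; rewrite (size_inactive vP (mem_head _ _) a_in).
  exact: inactive_derives.
- by rewrite /status /= -/(status l) -/(status l') sE; case: vv' => -> ->.
- rewrite /word /status /= -/(word l) -/(word l') -/(word l2) -/(status l).
  by rewrite mix_cat ?size_nseq ?mixE ?l2w //; case: vv'.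
- by rewrite /word /= !size_cat -/(word l) -/(word l') wE; case: vv' => ->.
Qed.

End Swap.

(** * Mixed trees and the pigeonhole argument *)

Lemma size_branches h u : size u + (size (branches h u) + size u) =
  tree_size (size u) h.
Proof.
by rewrite -size_tree treeE !size_cat size_opening size_closing.
Qed.

Lemma shape_branches h u v : size u = size v ->
  map fst (branches h u) = map fst (branches h v).
Proof. by move=> uv; case: h => //= h; rewrite !map_cat (shape_tree _ uv). Qed.

(** At the cut node one block comes from [u] and the other from [v], while the mixed branches
    between them keep the shape of a Dyck word. *)
Lemma mix_tree_not_dyck n h s u v : size u = n -> size v = n -> u != v ->
  has_cut n h s -> ~ dyck (mix s (tree h u) (tree h v)).
Proof.
move=> un vn uv [a [h' [b [s1 [s2 [s3 [sub -> s1a s2n]]]]]]].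
have [d /[dup] /(_ u un)[p [q [-> pa qd]]] /(_ v vn)[p' [q' [-> p'a q'd]]]] :=
  subtreeP sub.
have s2u : size s2 = size (branches h' u).
  by have := size_branches h' u; rewrite un; lia.
have s2v : size s2 = size (branches h' v).
  by have := size_branches h' v; rewrite vn; lia.
rewrite !treeE -!catA.
do 4?rewrite mix_cat ?size_nseq ?size_opening ?size_closing ?s1a //.
rewrite !mix_nseq ?size_opening ?size_closing //.
have shE : map fst (mix s2 (branches h' u) (branches h' v)) =
    map fst (branches h' u).
  by apply: map_mix => //; apply: shape_branches; rewrite un.
have brD : dyck (branches h' u) by apply: run_branches.
case: b => /= /(dyck_block_inj _ brD shE) E; move: uv;
  by rewrite E ?eqxx // un vn.
Qed.

Lemma dyck_not_ET0L_FIN : ~ ET0L_FIN dyck.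
Proof.
case=> E [k [Ek DE]].
have [c rule_size] : exists c, forall (t : seq_sub (et0l_tables E)) a alpha,
    (a, alpha) \in ssval t -> size alpha <= c.
  exists (\max_(t <- et0l_tables E) \max_(p <- t) size p.2) => t a alpha ta.
  apply: leq_trans (leq_bigmax_seq _ (ssvalP t) isT).
  exact: (leq_bigmax_seq (F := fun p => size p.2) (a, alpha) ta isT).
pose h := k.*2; pose C := tree_size 1 h.
(* [C * n + k.+1] is [M.+1] below, so the power counts the codes of profiles and [2 ^ n] the blocks;
   [n] above [k + c * k] meets the size conditions of [annotated_cut]. *)
have [n n0 nP] := exp_beats_poly C k.+1 #|et0l_letter E| k (k + c * k).+1.
pose M := n * C + k.
have codeP (u : n.-tuple bool) : exists code : k.+1.-tuple (gap (et0l_letter E) M),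
    exists l ts1 ts2, [/\ derives ts1 (et0l_start E) (map fst l), yields ts2 l,
    word l = tree h u, has_cut n h (status l) & decode code = profile l].
  have /DE/Ek[s [[ds ls] ks]] : dyck (tree h u) by apply: run_tree.
  have [|||l [ts1 [ts2 [l1 l2 lw lk cl]]]] :=
    annotated_cut rule_size (size_tuple u) _ _ _ ds ls ks; try by lia.
  have [|code codeE] := @profile_decode _ E k M ts2 l l2 lk.
    by rewrite lw size_tree size_tuple tree_sizeM.
  by exists code, l, ts1, ts2.
have [f fP] := fin_all_exists codeP.
have /injectivePn[u [v uv fuv]] : ~~ injectiveb f.
  apply/negP => /injectiveP/leq_card; apply/negP; rewrite -ltnNge.
  rewrite card_gap_tuple card_tuple card_bool.
  by apply: leq_ltn_trans nP; rewrite /M -addnS [n * C]mulnC.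
have [l [ts1 [ts2 [l1 l2 lw cl lf]]]] := fP u.
have [l' [_ [ts2' [_ l2' lw' _ lf']]]] := fP v.
have [|l3 [l3E l3P _ l3w _]] := swapP _ l2 l2'; first by rewrite -lf -lf' fuv.
apply: (mix_tree_not_dyck (size_tuple u) (size_tuple v) uv cl).
rewrite -lw -lw' -l3w; apply/DE.
(* The tables [ts1] of the derivation for [u] lead to the letters of [l], which [l3] shares; the
   tables [ts2'] of the one for [v] then derive the mixed word. *)
apply: (@derives_language _ _ (ts1 ++ ts2')).
apply: derives_trans l1 _; rewrite -l3E; exact: yields_derives.
Qed.

Theorem theorem31 : strictly_included ET0L_FIN IND_FIN.
Proof.
split; first exact: ET0L_FIN_IND_FIN.
exists bracket, dyck; split; [exact: dyck_IND_FIN | exact: dyck_not_ET0L_FIN].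
Qed.
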